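(* Let $k$ be an integer with $k\equiv 2\pmod 4$ and $k\ge 6$. Then the Möbius ladder $M_k$ satisfies $ced(M_k)=cvd(M_k)=1$.
   Context: Graphs are finite and may have multiple edges but not loops. A binary labeling of a graph $G$ is a function $f:V(G)\to\{0,1\}$. Two real numbers $x,y$ are roughly equal if $0\le |x-y|\le 1$. A binary labeling $f$ is friendly if $|f^{-1}(0)|$ and $|f^{-1}(1)|$ are roughly equal. A binary labeling $f$ induces an edge labeling $f_e:E(G)\to\{0,1\}$ by $f_e(uv)=f(u)+f(v)$ modulo 2. A friendly labeling $f$ of $G$ is cordial if $|f_e^{-1}(0)|$ and $|f_e^{-1}(1)|$ are roughly equal. The cordial edge deficiency $ced(G)$ is the minimum, over all friendly labelings $f$ of $G$, of the number of edges that must be added to $G$ between pairs of distinct vertices of $G$ (multiple edges allowed) so that $f$ becomes a cordial labeling of the augmented graph $G'$. The cordial vertex deficiency $cvd(G)$ is the minimum, over all binary labelings $f$ of $G$ (not necessarily friendly) for which $|f_e^{-1}(0)|$ and $|f_e^{-1}(1)|$ are roughly equal, of the number of labeled vertices (added as isolated vertices, with labels in $\{0,1\}$ chosen appropriately) that must be added to $G$ so that the resulting labeling of the augmented graph $G'$ is cordial; if no such binary labeling exists, $cvd(G)=\infty$. The Möbius ladder $M_k$ consists of the cycle $C_{2k}$ together with $k$ additional edges joining the opposite pairs of vertices of the cycle. *)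

(* Defs.v *)
From mathcomp Require Import all_boot ssrint boolp.

Set Implicit Arguments.
Unset Strict Implicit.
Unset Printing Implicit Defensive.

Local Open Scope nat_scope.

Definition vpair (V : finType) := {s : {set V} | #|s| == 2}.

Definition mk_pair (V : finType) (s : {set V}) (s2 : #|s| == 2) : vpair V :=
  exist (fun s : {set V} => #|s| == 2) s s2.

(* Multiplicity is carried by the edge type: several edges may have the same
   ends, and loops are excluded by [vpair]. *)
Record mgraph := MGraph {
  vert : finType;
  edge : finType;
  ends : edge -> vpair vert
}.

Definition labeling (G : mgraph) := {ffun vert G -> bool}.

Definition roughly_equal (m n : nat) : bool := `|m - n| <= 1.

(* [addb] is addition modulo 2, with [false] for 0 and [true] for 1. *)
Definition edge_label (G : mgraph) (f : labeling G) (e : edge G) : bool :=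
  \big[addb/false]_(v in val (ends e)) f v.

Definition friendly (G : mgraph) (f : labeling G) : bool :=
  roughly_equal #|[set v | f v == false]| #|[set v | f v == true]|.

Definition edge_balanced (G : mgraph) (f : labeling G) : bool :=
  roughly_equal #|[set e | edge_label f e == false]|
                #|[set e | edge_label f e == true]|.

Definition cordial (G : mgraph) (f : labeling G) : bool :=
  friendly f && edge_balanced f.

Definition add_edges (G : mgraph) (n : nat) (t : {ffun 'I_n -> vpair (vert G)})
    : mgraph :=
  @MGraph (vert G) (edge G + 'I_n)%type
    (fun e => match e with inl e0 => ends e0 | inr i => t i end).

Lemma inl_pairP (V W : finType) (p : vpair V) :
  #|[set (inl v : V + W) | v in val p]| == 2.
Proof. by rewrite card_imset ?(valP p) // => x y []. Qed.

Definition inl_pair (V W : finType) (p : vpair V) : vpair (V + W)%type :=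
  mk_pair (inl_pairP W p).

Definition add_vertices (G : mgraph) (n : nat) : mgraph :=
  @MGraph (vert G + 'I_n)%type (edge G) (fun e => inl_pair 'I_n (ends e)).

Definition extend_labeling (G : mgraph) (n : nat) (f : labeling G)
    (g : {ffun 'I_n -> bool}) : labeling (add_vertices G n) :=
  [ffun x : vert G + 'I_n => match x with inl v => f v | inr i => g i end].

(* [None] stands for infinity, the minimum of the empty set. *)
Definition nat_min (P : pred nat) : option nat :=
  match pselect (exists n, P n) with
  | left exP => Some (ex_minn exP)
  | right _ => None
  end.

Definition ced (G : mgraph) : option nat :=
  nat_min (fun n => [exists f : labeling G, friendly f &&
    [exists t : {ffun 'I_n -> vpair (vert G)}, @cordial (add_edges t) f]]).

Definition cvd (G : mgraph) : option nat :=
  nat_min (fun n => [exists f : labeling G, edge_balanced f &&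
    [exists g : {ffun 'I_n -> bool}, cordial (extend_labeling f g)]]).

(* The cycle visits 0, 1, ..., 2k - 1 in order, and [ordS] is the successor
   modulo 2k; for k = 1 the cycle is a pair of parallel edges. *)
Lemma rim_pairP (k : nat) (i : 'I_(k + k)) : #|[set i; ordS i]| == 2.
Proof.
rewrite cards2; suff -> : i != ordS i by [].
apply/eqP => /(congr1 val) /=; have := ltn_ord i.
case: k i => [|k] i; first by case: i.
case: (ltngtP i.+1 (k.+1 + k.+1)) => // [lt_i|eq_i] _.
  by rewrite modn_small // => /n_Sn.
by rewrite eq_i modnn => i0; rewrite i0 addSn addnS in eq_i.
Qed.

Lemma chord_pairP (k : nat) (j : 'I_k) : #|[set lshift k j; rshift k j]| == 2.
Proof. by rewrite cards2 eq_lrshift. Qed.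

Definition moebius_ladder (k : nat) : mgraph :=
  @MGraph 'I_(k + k) ('I_(k + k) + 'I_k)%type
    (fun e => match e with
              | inl i => mk_pair (rim_pairP i)
              | inr j => mk_pair (chord_pairP j)
              end).

(* Main.v *)
Require Import Defs.
From mathcomp Require Import all_boot.
From mathcomp Require Import ssrint boolp zify.

(** Every vertex of [M_k] has odd degree, so the number of edges labeled 1 has
    the parity of the number of vertices labeled 1.  A cordial labeling would
    have [k] vertices and [3k/2] edges labeled 1, but [k] is even and [3k/2] is
    odd; so both deficiencies are positive.

    For the upper bounds write [k = 4m + 2], label the first half of the cycle
    0, 1, 0, 1, ... with exactly [t] changes and the second half by the
    complement.  All chords are then labeled 1 and exactly [k] vertices are
    labeled 1.  With [t = m], the number of edges labeled 1 is [6m + 2] for [m]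
    odd and [6m + 4] for [m] even, and a further edge joining 0 to [k - 1] has
    label [m mod 2], which restores the balance.  With [t = m + 1] and the label
    of vertex 0 flipped, exactly [6m + 3] edges and [k + 1] vertices are
    labeled 1, and a new vertex labeled 0 suffices. *)

Set Implicit Arguments.
Unset Strict Implicit.
Unset Printing Implicit Defensive.

Lemma nat_min_eq1 (P : pred nat) : ~~ P 0 -> P 1 -> nat_min P = Some 1.
Proof.
move=> P0 P1; rewrite /nat_min; case: pselect => [exP|[]]; last by exists 1.
congr Some; case: ex_minnP => -[|[|n]] Pn min_n //; first by rewrite Pn in P0.
by have := min_n 1 P1.
Qed.

Lemma roughly_equalE (m n : nat) :
  roughly_equal m n = (m <= n.+1) && (n <= m.+1).
Proof. rewrite /roughly_equal; lia. Qed.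

Lemma card_set_true (T : finType) (P : T -> bool) :
  #|[set x | P x == true]| = \sum_x P x.
Proof. by rewrite -sum1dep_card big_mkcond; apply: eq_bigr => x _; case: (P x). Qed.

Lemma card_set_false (T : finType) (P : T -> bool) :
  #|[set x | P x == false]| = #|T| - \sum_x P x.
Proof.
rewrite -card_set_true -(cardsC [set x | P x == true]) addKn.
by apply: eq_card => x; rewrite !inE; case: (P x).
Qed.

Lemma sum_bool_le_card (T : finType) (P : T -> bool) : \sum_x P x <= #|T|.
Proof. by rewrite -card_set_true max_card. Qed.

(** The two counts are [total - ones] and [ones], so their difference is [total] minus twice [ones];
    this form avoids truncated subtraction. *)
Definition balanced_sum (total ones : nat) : bool :=
  (total <= ones.*2.+1) && (ones.*2 <= total.+1).

Lemma roughly_equal_sum (T : finType) (P : T -> bool) :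
  roughly_equal #|[set x | P x == false]| #|[set x | P x == true]|
  = balanced_sum #|T| (\sum_x P x).
Proof.
rewrite roughly_equalE card_set_true card_set_false /balanced_sum.
have := sum_bool_le_card P; lia.
Qed.

Lemma friendlyE (G : mgraph) (f : labeling G) :
  friendly f = balanced_sum #|vert G| (\sum_v f v).
Proof. exact: roughly_equal_sum. Qed.

Lemma edge_balancedE (G : mgraph) (f : labeling G) :
  edge_balanced f = balanced_sum #|edge G| (\sum_e edge_label f e).
Proof. exact: roughly_equal_sum. Qed.

Lemma edge_balanced_add_edges (G : mgraph) (n : nat)
    (t : {ffun 'I_n -> vpair (vert G)}) (f : labeling G) :
  @edge_balanced (add_edges t) f
  = balanced_sum (#|edge G| + n)
      (\sum_e edge_label f e + \sum_i \big[addb/false]_(v in val (t i)) f v).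
Proof. by rewrite edge_balancedE card_sum card_ord big_sumType. Qed.

Lemma edge_label_extend (G : mgraph) (n : nat) (f : labeling G)
    (g : {ffun 'I_n -> bool}) (e : edge G) :
  edge_label (extend_labeling f g) e = edge_label f e.
Proof.
rewrite /edge_label /= big_imset /=; last by move=> x y _ _ [].
by apply: eq_bigr => v _; rewrite ffunE.
Qed.

Lemma edge_balanced_extend (G : mgraph) (n : nat) (f : labeling G)
    (g : {ffun 'I_n -> bool}) :
  edge_balanced (extend_labeling f g) = edge_balanced f.
Proof.
rewrite !edge_balancedE; congr balanced_sum.
by apply: eq_bigr => e _; rewrite edge_label_extend.
Qed.

Lemma friendly_extend (G : mgraph) (n : nat) (f : labeling G)
    (g : {ffun 'I_n -> bool}) :
  friendly (extend_labeling f g)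
  = balanced_sum (#|vert G| + n) (\sum_v f v + \sum_i g i).
Proof.
rewrite friendlyE card_sum card_ord big_sumType; congr balanced_sum.
by congr (_ + _); apply: eq_bigr => v _; rewrite ffunE.
Qed.

(** With no edge added the label counts are those of [G], so deficiency 0 would give a cordial
    labeling of [G] itself. *)
Lemma ced_eq1 (G : mgraph) :
    (forall f : labeling G, ~~ cordial f) ->
    (exists (f : labeling G) (p : vpair (vert G)), friendly f &&
       balanced_sum (#|edge G|).+1
         (\sum_e edge_label f e + \big[addb/false]_(v in val p) f v)) ->
  ced G = Some 1.
Proof.
move=> noncordial [f [p /andP[fr bal]]]; apply: nat_min_eq1.
  apply/existsP => -[h /andP[fr_h /existsP[t /andP[_ bal_h]]]].
  have := noncordial h; rewrite /cordial fr_h edge_balancedE.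
  by move: bal_h; rewrite edge_balanced_add_edges big_ord0 !addn0 => ->.
apply/existsP; exists f; rewrite fr; apply/existsP; exists [ffun=> p].
by rewrite /cordial edge_balanced_add_edges big_ord1 ffunE addn1 bal andbT.
Qed.

Lemma cvd_eq1 (G : mgraph) :
    (forall f : labeling G, ~~ cordial f) ->
    (exists (f : labeling G) (b : bool), edge_balanced f &&
       balanced_sum (#|vert G|).+1 (\sum_v f v + b)) ->
  cvd G = Some 1.
Proof.
move=> noncordial [f [b /andP[bal fr]]]; apply: nat_min_eq1.
  apply/existsP => -[h /andP[bal_h /existsP[g /andP[fr_h _]]]].
  have := noncordial h; rewrite /cordial bal_h andbT friendlyE.
  by move: fr_h; rewrite friendly_extend big_ord0 !addn0 => ->.
apply/existsP; exists f; rewrite bal; apply/existsP; exists [ffun=> b].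
rewrite /cordial edge_balanced_extend bal friendly_extend.
by rewrite big_ord1 ffunE addn1 fr.
Qed.

Lemma big_addb_pair (V : finType) (f : V -> bool) (x y : V) :
  #|[set x; y]| == 2 -> \big[addb/false]_(v in [set x; y]) f v = f x (+) f y.
Proof.
rewrite cards2; case: (eqVneq x y) => // neq_xy _.
by rewrite big_setU1 ?inE //= big_set1.
Qed.

Section MoebiusLadder.

Variable k : nat.
Local Notation M := (moebius_ladder k).

Lemma sum_edge_label_moebius (f : labeling M) :
  \sum_(e : edge M) edge_label f e
  = \sum_(i < k + k) (f i (+) f (ordS i))
    + \sum_(j < k) (f (lshift k j) (+) f (rshift k j)).
Proof.
rewrite big_sumType /=; congr (_ + _); apply: eq_bigr => i _.
  by rewrite /edge_label big_addb_pair ?rim_pairP.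
by rewrite /edge_label big_addb_pair ?chord_pairP.
Qed.

Lemma odd_sum_bool (I : finType) (P : I -> bool) :
  odd (\sum_i P i) = \big[addb/false]_i P i.
Proof.
rewrite (big_morph odd oddD (erefl : odd 0 = false)).
by apply: eq_bigr => i _; rewrite oddb.
Qed.

(** Modulo 2 the rim cancels, since [ordS] permutes the vertices, and the chords form a perfect
    matching, which meets each vertex once. *)
Lemma odd_sum_edge_label_moebius (f : labeling M) :
  odd (\sum_(e : edge M) edge_label f e) = odd (\sum_(v : vert M) f v).
Proof.
rewrite sum_edge_label_moebius oddD !odd_sum_bool !big_split /=.
have <- : \big[addb/false]_i f i = \big[addb/false]_(i < k + k) f (ordS i).
  exact: reindex_inj (@ordS_inj (k + k)).
by rewrite addbb addFb big_split_ord.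
Qed.

Lemma card_vert_moebius : #|vert M| = k + k.
Proof. exact: card_ord. Qed.

Lemma card_edge_moebius : #|edge M| = k + k + k.
Proof. by rewrite card_sum !card_ord. Qed.

Lemma moebius_noncordial (f : labeling M) : k %% 4 = 2 -> ~~ cordial f.
Proof.
move=> k4; apply/negP; rewrite /cordial friendlyE edge_balancedE.
rewrite card_vert_moebius card_edge_moebius /balanced_sum.
have := odd_sum_edge_label_moebius f.
(* Both totals are even, so balance forces exact halves. *)
move: (\sum_e _) (\sum_v _) => c s; lia.
Qed.

End MoebiusLadder.

(* [t] counts the changes along 0, 1, ... when [c] is [false]; the role of [c]
   is to flip the label of 0. *)
Definition zigzag (t : nat) (c : bool) (i : nat) : bool :=
  if i is 0 then c else odd (minn i t).

Lemma zigzag_const (t n : nat) (c : bool) :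
  0 < t -> t <= n -> zigzag t c n = odd t.
Proof.
move=> t_gt0 t_len; rewrite /zigzag (minn_idPr t_len).
by case: n t_len => //; lia.
Qed.

(** Position 1 has label 1 because [0 < t], so [c = true] removes just the first change. *)
Lemma sum_zigzag_changes (t n : nat) (c : bool) : 0 < t ->
  \sum_(i < n.+1) (zigzag t c i (+) zigzag t c i.+1) = minn n.+1 t - c.
Proof.
move=> t_gt0; elim: n => [|n IHn]; rewrite big_ord_recr /=.
  by rewrite big_ord0; case: c; case: t t_gt0 => [|[|t]].
rewrite IHn; lia.
Qed.

Section LadderLabeling.

Variables (n t : nat) (c : bool).
Local Notation k := n.+1.
Hypotheses (t_gt0 : 0 < t) (t_len : t <= n).

(** The second half complements the unflipped zigzag, so [c] affects vertex 0 alone. *)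
Definition ladder_bit (i : nat) : bool :=
  if i < k then zigzag t c i else ~~ zigzag t false (i - k).

Definition ladder_labeling : labeling (moebius_ladder k) :=
  [ffun i : 'I_(k + k) => ladder_bit i].

Lemma ladder_bit_lshift (i : nat) : i < k -> ladder_bit i = zigzag t c i.
Proof. by rewrite /ladder_bit => ->. Qed.

Lemma ladder_bit_rshift (i : nat) : ladder_bit (k + i) = ~~ zigzag t false i.
Proof. by rewrite /ladder_bit ltnNge leq_addr addKn. Qed.

Lemma sum_ladder_labeling :
  \sum_(v : vert (moebius_ladder k)) ladder_labeling v = k + c.
Proof.
rewrite big_split_ord /= -big_split /= big_ord_recl /=.
rewrite (eq_bigr (fun=> 1)) => [|i _]; last first.
  rewrite !ffunE /= ladder_bit_lshift ?ltnS // ladder_bit_rshift /=.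
  by case: odd.
rewrite sum1_card card_ord !ffunE /= ladder_bit_lshift // ladder_bit_rshift /=; lia.
Qed.

Lemma sum_ladder_chords :
  \sum_(j < k) (ladder_labeling (lshift k j) (+) ladder_labeling (rshift k j))
  = k - c.
Proof.
rewrite big_ord_recl (eq_bigr (fun=> 1)) => [|i _]; last first.
  rewrite !ffunE /= ladder_bit_lshift ?ltnS // ladder_bit_rshift /=.
  by case: odd.
rewrite sum1_card card_ord !ffunE /= addn0 -[in ladder_bit k](addn0 k).
rewrite ladder_bit_lshift // ladder_bit_rshift /=; case: c => /=; lia.
Qed.

(** The halves have [t - c] and [t] changes inside. The other two terms are the edges joining the
    halves: from [n] to [k], with labels [odd t] and 1, and from the last vertex back to 0, with
    labels [~~ odd t] and [c]. *)
Lemma sum_ladder_rim :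
  \sum_(i < k + k) (ladder_labeling i (+) ladder_labeling (ordS i))
  = t.*2 - c + ~~ odd t + (~~ odd t (+) c).
Proof.
under eq_bigr => i _ do rewrite !ffunE /=.
have n_gt0 : 0 < n by lia.
rewrite big_split_ord /= !big_ord_recr /=.
have changes b := @sum_zigzag_changes t n.-1 b t_gt0.
rewrite prednK // (minn_idPr t_len) in changes.
rewrite (eq_bigr (fun i : 'I_n => nat_of_bool (zigzag t c i (+) zigzag t c i.+1)))
  => [|i _]; last first.
  have lt_in := ltn_ord i.
  by rewrite modn_small ?ladder_bit_lshift //; lia.
rewrite changes.
rewrite (eq_bigr
  (fun i : 'I_n => nat_of_bool (zigzag t false i (+) zigzag t false i.+1)))
  => [|i _]; last first.
  have lt_in := ltn_ord i.
  by rewrite modn_small -?addnS ?ladder_bit_rshift ?addbN ?addNb ?negbK //; lia.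
(* Of the two joining edges only the last one wraps around modulo [k + k]. *)
rewrite changes (@modn_small k) -?addnS ?modnn; last by lia.
rewrite -[in ladder_bit k](addn0 k) !ladder_bit_rshift !ladder_bit_lshift //.
rewrite /= !zigzag_const //; case: c => /=; lia.
Qed.

End LadderLabeling.

Theorem theorem5 (k : nat) (k_mod4 : k = 2 %[mod 4]) (k_ge6 : 6 <= k) :
  ced (moebius_ladder k) = Some 1 /\ cvd (moebius_ladder k) = Some 1.
Proof.
have noncordial (f : labeling (moebius_ladder k)) : ~~ cordial f.
  exact: moebius_noncordial.
have [m k_eq] : exists m, k = m * 4 + 2 by exists (k %/ 4); lia.
case: k => [|n] in k_mod4 k_ge6 noncordial k_eq *; first by [].
(* These bounds let both [m] and [m.+1] serve as the number of changes in a half. *)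
have [m_gt0 m_ltn] : 0 < m /\ m < n by lia.
split.
- apply: ced_eq1 => //.
  have p_card : #|[set (ord0 : 'I_(n.+1 + n.+1)); lshift n.+1 ord_max]| == 2.
    by rewrite cards2 -val_eqE /=; lia.
  have m_len := ltnW m_ltn.
  (* The new edge turns [6m + 2] into [6m + 3] for odd [m] and keeps [6m + 4] for even [m]; the new
     total [12m + 7] allows both. *)
  exists (ladder_labeling n m false), (mk_pair p_card).
  rewrite friendlyE sum_ladder_labeling // card_vert_moebius /=.
  rewrite big_addb_pair // !ffunE /= ladder_bit_lshift // zigzag_const //.
  rewrite card_edge_moebius sum_edge_label_moebius sum_ladder_rim
    ?sum_ladder_chords //.
  rewrite /balanced_sum; lia.
- apply: cvd_eq1 => //.
  (* With [c = true] exactly one joining edge has label 1, so the count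
     [(2m + 1) + 1 + (k - 1) = 6m + 3] is the same for both parities of [m]. *)
  exists (ladder_labeling n m.+1 true), false.
  rewrite edge_balancedE sum_ladder_labeling // card_vert_moebius.
  rewrite card_edge_moebius sum_edge_label_moebius sum_ladder_rim
    ?sum_ladder_chords //.
  rewrite /balanced_sum; lia.
Qed.
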